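(* Let $\epsilon$ be a rational number with $0<\epsilon\le 1$. Let $G$ be a $(2-\epsilon)$-tough graph with at least three vertices. If $\delta(G)\ge \epsilon\,\alpha(G)$, then $G$ contains a $2$-factor.
   Context: Graphs are finite and simple. $\delta(G)$ denotes the minimum degree of $G$, and $\alpha(G)$ the independence number of $G$ (the maximum cardinality of a set of pairwise nonadjacent vertices). A $2$-factor of $G$ is a spanning subgraph of $G$ in which every vertex has degree $2$ (not necessarily connected). For a graph $H$, $c(H)$ denotes the number of connected components of $H$, and for $S\subset V(G)$, $G-S$ is the subgraph of $G$ induced by $V(G)\setminus S$. The toughness $\tau(G)$ is $\infty$ if $G$ is complete; otherwise $\tau(G)=\min \frac{|S|}{c(G-S)}$, the minimum being over all vertex cuts $S$ of $G$, i.e. all $S\subset V(G)$ with $c(G-S)>1$ (if $G$ is disconnected, $S=\emptyset$ is allowed, so $\tau(G)=0$). For a positive real number $t$, $G$ is $t$-tough if $\tau(G)\ge t$. *)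

(* Defs.v *)
From mathcomp Require Import all_boot all_order all_algebra constructive_ereal.

Set Implicit Arguments.
Unset Strict Implicit.
Unset Printing Implicit Defensive.

Import Order.TTheory GRing.Theory Num.Theory.

(* Finite simple graphs with vertex set [T]. *)
Record sgraph (T : finType) := SGraph {
  adj :> rel T;
  adj_sym : symmetric adj;
  adj_irr : irreflexive adj }.

Section Graph.
Variables (T : finType) (G : sgraph T).

Definition degree (x : T) : nat := #|[set y | G x y]|.

(* The default value [#|T|] exceeds every degree, so it matters only when [T]
   is empty. *)
Definition min_degree : nat := \big[minn/#|T|]_(x : T) degree x.

Definition independent (A : {set T}) : bool :=
  [forall x in A, forall y in A, ~~ G x y].

Definition indep_num : nat := \max_(A : {set T} | independent A) #|A|.

Definition complete : bool := [forall x, forall y, (x != y) ==> G x y].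

Definition num_components : nat := n_comp G T.

Definition delete_rel (S : {set T}) : rel {x : T | x \in ~: S} :=
  fun u v => G (val u) (val v).

Lemma delete_rel_sym S : symmetric (@delete_rel S).
Proof. by move=> u v; apply: adj_sym. Qed.

Lemma delete_rel_irr S : irreflexive (@delete_rel S).
Proof. by move=> u; apply: adj_irr. Qed.

Definition delete_vertices (S : {set T}) : sgraph {x : T | x \in ~: S} :=
  SGraph (@delete_rel_sym S) (@delete_rel_irr S).

End Graph.

Section Toughness.
Variables (T : finType) (G : sgraph T).

Definition vertex_cut (S : {set T}) : bool :=
  (1 < num_components (delete_vertices G S))%N.

(* A graph that is not complete has a vertex cut, so in the second branch the
   default value [+oo] of the minimum is never attained. *)
Definition toughness : \bar rat :=
  if complete G then +oo%E
  else \big[Order.min/+oo%E]_(S : {set T} | vertex_cut S)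
         (#|S|%:R / (num_components (delete_vertices G S))%:R)%R%:E.

Definition tough (t : rat) : bool := (t%:E <= toughness)%E.

Definition spanning_subgraph (H : sgraph T) : Prop := subrel H G.

Definition two_factor (H : sgraph T) : Prop :=
  spanning_subgraph H /\ forall x : T, degree H x = 2.

End Toughness.

(* Main.v *)
Require Import Defs.
From HB Require Import structures.
From mathcomp Require Import all_boot all_order all_algebra constructive_ereal.
From mathcomp Require Import zify lra.

Set Implicit Arguments.
Unset Strict Implicit.
Unset Printing Implicit Defensive.

(** Suppose that [G] has no 2-factor. The 2-factors of [G] correspond to the
    perfect matchings of an auxiliary graph [gadget], so Tutte's theorem
    gives a set of vertices of the gadget that leaves too many odd
    components. Tutte's theorem is proved here by Gallai's argument
    ([never_both_trans], [tutte_barrier]). A minimal such set satisfies a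
    strong Hall condition ([tutte_hall_barrier]): each nonempty subset [W]
    of it sees at least [#|W| + 2] odd components.

    Translated back to [G] ([two_factor_or_barrier]), this yields disjoint
    vertex sets [A] and [B] such that [B] is independent, distinct edges
    from one vertex of [B] to the outside of [A] lead to distinct components
    of [G - A - B], and each component that is reached in this way receives
    an odd number of edges from [B]. If [P] is the set of edges from [B] to
    the outside of [A] and [h] is the number of components that they reach,
    then [2|A| + |P| + 2 <= 2|B| + h].

    Two cuts are now played against the minimum degree. Deleting [A],
    together with the outer ends of all edges of [P] but one for each
    component, separates the vertices of [B] ([tough_hit_edges]). This costs
    at most [|A| + |P| - h] vertices, so toughness [2 - eps] gives [|A| + 2
    <= eps |B|], and hence [|A| + 2 <= eps alpha <= delta]. If [delta >= |A|
    + 3], then [|P| >= 3|B|] and therefore [h > |A| + |B|], although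
    deleting [A] and [B] leaves at least [h] components
    ([tough_hit_labels]). So [delta = |A| + 2], which makes every estimate
    tight: [|B| = alpha], and no two edges of [P] share their outer end
    ([tough_common_end]). But then a vertex of [B] can be exchanged for two
    of its neighbours outside [A], which gives a larger independent set
    ([exchange_indep]). *)

(** * Involutions and odd components *)

(** Orbits of an involution have one or two points. *)
Lemma odd_card_fixed_points (V : finType) (f : V -> V) (D : {set V}) :
    {in D, forall x, f x \in D} -> {in D, involutive f} ->
  odd #|D| = odd #|[set x in D | f x == x]|.
Proof.
have [n] := ubnP #|D|; elim: n D => // n IH D leDn fD fK.
case: (pickP [pred x in D | f x != x]) => [x /= /andP[xD fx]|fix_all]; last first.
  congr (odd #|pred_of_set _|); apply/setP => x; rewrite inE.
  case: (boolP (x \in D)) => //= xD.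
  by move: (fix_all x); rewrite /= xD /= => /negbFE.
pose D' := D :\ x :\ f x.
have cardD : #|D| = #|D'|.+2.
  by rewrite (cardsD1 x D) xD (cardsD1 (f x) (D :\ x)) !inE fx fD.
have D'E y : y \in D' = [&& y != f x, y != x & y \in D] by rewrite !inE.
rewrite cardD /= negbK IH; first last.
- by move=> y; rewrite D'E => /and3P[_ _ /fK].
- move=> y; rewrite !D'E => /and3P[yfx yx yD]; rewrite fD // andbT.
  rewrite (inj_in_eq (can_in_inj fK)) // yx /=.
  by apply: contraNneq yfx => <-; rewrite fK.
- by rewrite cardD in leDn; lia.
congr (odd #|pred_of_set _|); apply/setP => y; rewrite [LHS]inE [RHS]inE D'E.
case: (eqVneq y x) => [->|_]; first by rewrite (negPf fx) !andbF.
case: (eqVneq y (f x)) => [->|_] //=.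
by rewrite fK // eq_sym (negPf fx) !andbF.
Qed.

Section Components.
Variables (V : finType) (e : rel V).
Hypothesis e_sym : symmetric e.
Implicit Types (U W C D : {set V}) (x y : V).

Definition del U : rel V := [rel x y | [&& x \notin U, y \notin U & e x y]].

Definition component U x : {set V} := [set y | connect (del U) x y].

Definition odd_comps U : {set {set V}} :=
  [set C in [set component U x | x in ~: U] | odd #|C|].

Definition odd_nbrs U W : {set {set V}} :=
  [set C in odd_comps U | [exists w in W, [exists x in C, e w x]]].

Lemma del_connect_sym U : connect_sym (del U).
Proof.
by apply: sym_connect_sym => x y; rewrite /del /= e_sym andbCA.
Qed.

Lemma mem_component U x : x \in component U x.
Proof. by rewrite inE connect0. Qed.

Lemma component_eq U x y : y \in component U x -> component U y = component U x.
Proof.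
rewrite inE => xy; apply/setP => z; rewrite !inE.
exact/esym/(same_connect (@del_connect_sym U)).
Qed.

Lemma component_adj U x y :
  x \notin U -> y \notin U -> e x y -> component U x = component U y.
Proof.
move=> xU yU xy; apply/esym/component_eq.
by rewrite inE connect1 // /del /= xU yU.
Qed.

Lemma component_min U D x :
    x \in D -> (forall y z, y \in D -> del U y z -> z \in D) ->
  component U x \subset D.
Proof.
move=> xD closD; apply/subsetP => y; rewrite inE => /connectP[p].
elim: p x xD => [|z p IH] x xD /=; first by move=> _ ->.
by case/andP=> xz; apply: IH; apply: closD xz.
Qed.

Lemma component_notin U x : x \notin U -> component U x \subset ~: U.
Proof.
move=> xU; apply: component_min; first by rewrite inE.
by move=> y z _ /and3P[_]; rewrite inE.
Qed.

Lemma odd_compsP U C :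
  reflect (exists x, [/\ x \notin U, C = component U x & odd #|component U x|])
          (C \in odd_comps U).
Proof.
rewrite inE; apply: (iffP andP) => [[/imsetP[x xU ->] oC]|[x [xU -> oC]]].
  by exists x; split=> //; rewrite inE in xU.
by split=> //; apply/imsetP; exists x; rewrite ?inE.
Qed.

Lemma odd_comps_mem U C x :
  C \in odd_comps U -> x \in C -> C = component U x /\ x \notin U.
Proof.
case/odd_compsP=> y [yU -> _] xy; split; first by rewrite (component_eq xy).
by move/subsetP: (component_notin yU) => /(_ x xy); rewrite inE.
Qed.

Lemma odd_card_odd_comps U : odd #|odd_comps U| = odd #|~: U|.
Proof.
set P := [set component U x | x in ~: U].
have -> : #|~: U| = \sum_(C in P) #|C|.
  rewrite -sum1_card (partition_big_imset (component U)) /=.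
  apply: eq_bigr => C /imsetP[x xU ->]; rewrite -sum1_card; apply: eq_bigl => y.
  rewrite inE in xU; apply/andP/idP => [[_ /eqP <-]|xy]; first exact: mem_component.
  by rewrite (component_eq xy) (subsetP (component_notin xU)).
rewrite -sum1_card big_mkcond /= [in RHS]big_mkcond /=.
elim/big_ind2: _ => // [m1 n1 m2 n2|C _]; first by rewrite !oddD => -> ->.
by rewrite inE -/P; case: (C \in P) => //=; case: (odd #|C|).
Qed.

(** Putting [W] back merges only the components that [W] sees. *)
Lemma odd_comps_setD U W :
  odd_comps U :\: odd_nbrs U W \subset odd_comps (U :\: W).
Proof.
apply/subsetP => C; rewrite inE => /andP[nWC oC].
have nW w x : w \in W -> x \in C -> ~~ e w x.
  move=> wW xC; apply: contra nWC => wx; rewrite inE oC /=.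
  by apply/exists_inP; exists w => //; apply/exists_inP; exists x.
have [x [xU CE odd_C]] := odd_compsP _ _ oC.
have xC : x \in C by rewrite CE mem_component.
have sUD y : y \notin U -> y \notin U :\: W.
  by move=> yU; rewrite inE (negPf yU) andbF.
have CE' : component (U :\: W) x = C.
  apply/eqP; rewrite eqEsubset; apply/andP; split.
    apply: component_min => // y z yC /and3P[_ zU' yz].
    have [CEy yU] := odd_comps_mem oC yC.
    have zU : z \notin U.
      apply: contraNN zU' => zU; rewrite inE zU andbT.
      by apply: contraL yz => zW; rewrite e_sym nW.
    by rewrite CEy (component_adj yU zU yz) mem_component.
  suff: component U x \subset component (U :\: W) x by rewrite -CE.
  apply: component_min; first exact: mem_component.
  move=> y z yx /and3P[yU zU yz].
  by rewrite -(component_eq yx) (@component_adj _ y z) ?mem_component ?sUD.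
by apply/odd_compsP; exists x; rewrite CE' [in odd _]CE; split; rewrite ?sUD.
Qed.

End Components.

(** * Matchings and barriers *)

Section Matchings.
Variables (V : finType) (e : rel V).
Hypothesis e_sym : symmetric e.
Implicit Types (U W C D : {set V}) (x y : V) (M N : {ffun V -> V}).

(** A matching of the graph without [U] is encoded as the involution that
    exchanges the ends of its edges and fixes the vertices that it misses. *)
Definition matching U M : bool :=
  [forall x, (M (M x) == x) && ((M x != x) ==> (x \notin U) && e x (M x))].

Definition missed M : {set V} := [set x | M x == x].

Lemma matchingP U M :
  reflect (involutive M /\ forall x, M x != x -> x \notin U /\ e x (M x))
          (matching U M).
Proof.
apply: (iffP forallP) => [mM|[MK eM] x].
  split=> x; have /andP[/eqP MK /implyP eM] := mM x; first by [].
  by case/eM/andP.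
by rewrite MK eqxx; apply/implyP => /eM[-> ->].
Qed.

Lemma matchingS U W M : U \subset W -> matching W M -> matching U M.
Proof.
move=> sUW /matchingP[MK eM]; apply/matchingP; split=> // x /eM[xW ->].
by split=> //; apply: contraNN xW; apply: (subsetP sUW).
Qed.

Lemma odd_card_missed U M : matching U M -> odd #|missed M| = odd #|V|.
Proof.
case/matchingP => MK _; rewrite -cardsT [RHS](@odd_card_fixed_points V M) //.
by congr (odd #|pred_of_set _|); apply/setP => x; rewrite !inE.
Qed.

Lemma sub_missed U M : matching U M -> U \subset missed M.
Proof.
case/matchingP=> _ eM; apply/subsetP => x xU; rewrite inE.
by apply: contraLR xU => /eM[].
Qed.

(** An augmentation when [N] misses [x] and [y], an exchange of edges when it
    misses [x] only. *)
Definition force N x y : {ffun V -> V} :=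
  [ffun w => if w == x then y else if w == y then x
             else if w == N y then w else N w].

Section Force.
Variables (U : {set V}) (N : {ffun V -> V}) (x y : V).
Hypotheses (matN : matching U N) (Nx : N x = x) (yx : y != x).

Lemma missed_force : missed (force N x y) =
  if N y == y then missed N :\ x :\ y else N y |: missed N :\ x.
Proof.
have [NK _] := matchingP _ _ matN.
apply/setP => w; case: eqP => Ny; rewrite !inE ffunE.
  rewrite Ny; case: (eqVneq w x) => [->|wx]; first by rewrite (negPf yx) andbF.
  by case: (eqVneq w y) => [->|wy] //=; rewrite eq_sym (negPf yx).
have Nyx : N y != x by apply: contraNneq yx => Nyx; rewrite -(NK y) Nyx Nx.
case: (eqVneq w x) => [->|wx]; first by rewrite (negPf yx) eq_sym (negPf Nyx).
case: (eqVneq w y) => [->|wy].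
  by rewrite (introF eqP Ny) eq_sym (negPf yx) eq_sym (introF eqP Ny).
by case: (eqVneq w (N y)) => [->|] //=; rewrite eqxx.
Qed.

Lemma matching_force :
  x \notin U -> y \notin U -> e x y -> matching U (force N x y).
Proof.
move=> xU yU exy; have [NK eN] := matchingP _ _ matN.
have NI := can_inj NK.
apply/matchingP; split=> w; rewrite ?[force N x y w]ffunE.
  case: (eqVneq w x) => [->|wx]; first by rewrite ffunE (negPf yx) eqxx.
  case: (eqVneq w y) => [->|wy]; first by rewrite ffunE eqxx.
  case: (eqVneq w (N y)) => [wNy|wNy].
    by rewrite ffunE (negPf wx) (negPf wy) -wNy eqxx.
  rewrite ffunE; have -> : (N w == x) = false.
    by apply: contraNF wx => /eqP Nw; rewrite -Nx -Nw NK.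
  have -> : (N w == y) = false.
    by apply: contraNF wNy => /eqP <-; rewrite NK.
  by rewrite (inj_eq NI) (negPf wy) NK.
case: (eqVneq w x) => [->|wx] //.
case: (eqVneq w y) => [->|wy]; first by rewrite e_sym.
case: (eqVneq w (N y)) => _; first by rewrite eqxx.
exact: eN.
Qed.

End Force.

Section Gallai.
Variables (U : {set V}) (k : nat).
Hypothesis min_missed : forall M, matching U M -> k <= #|missed M|.
Hypothesis all_missed : forall x, x \notin U ->
  exists M, [/\ matching U M, #|missed M| = k & x \in missed M].

Definition never_both x y := forall M,
  matching U M -> #|missed M| = k -> x \in missed M -> y \in missed M -> x = y.

Lemma never_both_adj x y :
  x \notin U -> y \notin U -> e x y -> never_both x y.
Proof.
move=> xU yU exy M matM cM; rewrite !inE => /eqP Mx /eqP My.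
apply/esym/eqP; apply: contraT => yx.
have := min_missed (matching_force matM Mx yx xU yU exy).
rewrite (missed_force matM Mx yx) My eqxx -cM.
rewrite (cardsD1 x (missed M)) (cardsD1 y (missed M :\ x)) !inE Mx My eqxx yx.
by rewrite eqxx; lia.
Qed.

(** Suppose that the optimal matching [M] misses [u] and [v], and let the
    optimal matching [N] miss [t] and agree with [M] as much as possible. Then
    [N] covers [u] and [v], so besides [t] it misses another vertex [x] that [M]
    covers. Forcing the [M]-edge at [x] into [N] increases the agreement. *)
Lemma never_both_trans u t v :
  t \notin U -> never_both u t -> never_both t v -> never_both u v.
Proof.
move=> tU Rut Rtv M matM cM uM vM; apply/eqP; apply: contraT => uv.
have [N0 [matN0 cN0 tN0]] := all_missed tU.
have tM : t \notin missed M.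
  apply: contra uv => tM.
  by rewrite (Rut M matM cM uM tM) (Rtv M matM cM tM vM).
pose agree N := #|[set x | (M x != x) && (N x == M x)]|.
pose good N := [&& matching U N, #|missed N| == k & t \in missed N].
have good0 : good N0 by rewrite /good matN0 cN0 eqxx.
case: (@arg_maxnP _ N0 good agree good0) => N /and3P[matN /eqP cN tN] maxN.
have uN : u \notin missed N.
  by apply: contra tM => uN; rewrite -(Rut N matN cN uN tN).
have vN : v \notin missed N.
  by apply: contra tM => vN; rewrite (Rtv N matN cN tN vN).
have [x xNM xt] : exists2 x, x \in missed N :\: missed M & x != t.
  have : 1 < #|missed N :\: missed M|.
    have -> : #|missed N :\: missed M| = #|missed M :\: missed N|.
      apply/eqP; rewrite -(eqn_add2l #|missed N :&: missed M|) cardsID setIC.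
      by rewrite cardsID cM cN.
    have <- : #|[set u; v]| = 2 by rewrite cards2 uv.
    apply/subset_leq_card/subsetP => z.
    by rewrite in_set2 in_setD => /orP[]/eqP->; rewrite ?uM ?vM ?uN ?vN.
  rewrite (cardsD1 t) inE tN tM /= => c2.
  have /set0Pn[x] : (missed N :\: missed M) :\ t != set0 by rewrite -card_gt0.
  by rewrite in_setD1 => /andP[xt xNM]; exists x.
move: xNM; rewrite !inE => /andP[Mx /eqP Nx].
have [MK eM] := matchingP _ _ matM; have [NK _] := matchingP _ _ matN.
have [xU exy] := eM _ Mx; set y := M x in Mx exy.
have My : M y = x by rewrite /y MK.
have [yU _] : y \notin U /\ e y (M y) by apply: eM; rewrite My eq_sym.
have matN' := matching_force matN Nx Mx xU yU exy.
have mN' := missed_force matN Nx Mx.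
case: (eqVneq (N y) y) mN' => [Ny|Ny] mN'.
  have := min_missed matN'; rewrite mN' -cN.
  rewrite (cardsD1 x (missed N)) (cardsD1 y (missed N :\ x)) !inE Nx Ny !eqxx Mx.
  by rewrite !add1n ltnNge leqnSn.
have NyN : N y \notin missed N :\ x.
  by rewrite !inE NK [y == _]eq_sym (negPf Ny) andbF.
have good' : good (force N x y).
  apply/and3P; split=> //; rewrite mN'.
    by rewrite cardsU1 NyN -cN [in eqbRHS](cardsD1 x) !inE Nx eqxx.
  by rewrite in_setU1 in_setD1 [t == x]eq_sym xt tN orbT.
suff : agree N < agree (force N x y).
  by rewrite ltnNge => /negP[]; apply: maxN.
apply: proper_card; apply/properP; split.
  apply/subsetP => w; rewrite !inE ffunE => /andP[Mw /eqP Nw].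
  rewrite Mw /=; case: (eqVneq w x) => [->|wx] //.
  case: (eqVneq w y) => [->|wy]; first by rewrite My.
  case: (eqVneq w (N y)) => [wNy|]; last by rewrite Nw.
  by move: Nw; rewrite wNy NK => yE; case/eqP: wx; rewrite -My yE MK -wNy.
exists x; rewrite !inE ?ffunE ?eqxx ?Nx ?Mx //.
by rewrite [x == _]eq_sym (negPf Mx) andbF.
Qed.

Lemma never_both_connect x y :
  x \notin U -> connect (del e U) x y -> never_both x y.
Proof.
move=> xU /connectP[p]; elim: p x xU => [|z p IH] x xU /=.
  by move=> _ -> M.
case/andP=> /and3P[_ zU xz] pth yE.
apply: (never_both_trans zU); first exact: never_both_adj.
exact: IH.
Qed.

(** The matching stays inside each component and misses at most one vertex of
    it, so the missed vertices outside [U] lie in different odd components. *)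
Lemma missed_odd_comps M :
  matching U M -> #|missed M| = k -> k <= #|odd_comps e U| + #|U|.
Proof.
move=> matM cM; have [MK eM] := matchingP _ _ matM.
have Mcomp x y : x \notin U -> y \in component e U x -> M y \in component e U x.
  move=> xU yx; have yU : y \notin U.
    by have := subsetP (component_notin e xU) y yx; rewrite inE.
  case: (eqVneq (M y) y) => [-> //|My].
  have [_ eyM] := eM _ My; have [MyU _] : M y \notin U /\ e (M y) (M (M y)).
    by apply: eM; rewrite MK eq_sym.
  rewrite -(component_eq e_sym yx) (component_adj e_sym yU MyU eyM).
  exact: mem_component.
have inj_comp : {in missed M :\: U &, injective (component e U)}.
  move=> x y; rewrite !in_setD => /andP[xU xM] /andP[yU yM] xy.
  apply: (never_both_connect xU) matM cM xM yM.
  by have := mem_component e U y; rewrite -xy inE.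
have <- : #|missed M :\: U| + #|U| = k.
  by have := cardsID U (missed M); rewrite (setIidPr (sub_missed matM)) cM addnC.
rewrite leq_add2r -(card_in_imset inj_comp); apply/subset_leq_card/subsetP => C.
case/imsetP=> x; rewrite in_setD => /andP[xU xM] ->.
apply/odd_compsP; exists x; split=> //.
rewrite (@odd_card_fixed_points _ M); last 2 first.
- by move=> y; apply: Mcomp.
- by move=> y _; apply: MK.
suff -> : [set y in component e U x | M y == y] = [set x] by rewrite cards1.
apply/setP => y; rewrite [LHS]inE in_set1; apply/andP/eqP => [[xy My]|->].
  apply/esym; apply: (never_both_connect xU) matM cM xM _; last by rewrite inE.
  by rewrite inE in xy.
by rewrite mem_component; move: xM; rewrite inE.
Qed.

End Gallai.

(** The nontrivial half of the Tutte-Berge formula. Take [U] maximal such that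
    every matching of the graph without [U] has at least [#|U|] edges fewer than
    a maximum matching. By maximality, each vertex outside [U] is missed by a
    maximum matching of the graph without [U], so that two vertices in one
    component are never missed together. *)
Theorem tutte_barrier :
    ~~ odd #|V| -> (forall M, matching set0 M -> missed M != set0) ->
  exists U, #|U| + 2 <= #|odd_comps e U|.
Proof.
move=> evV no_perfect.
have mat_id W : matching W [ffun x => x].
  by apply/matchingP; split=> x; rewrite !ffunE // eqxx.
case: (@arg_minnP _ [ffun x => x] (matching set0) (fun M => #|missed M|)
         (mat_id _)).
move=> M0 matM0 minM0; set d := #|missed M0| in minM0.
have d2 : 2 <= d.
  have := odd_card_missed matM0; rewrite -/d (negPf evV).
  have : 0 < d by rewrite card_gt0 no_perfect.
  by case: (d) => [|[]].
pose P U := [forall M, matching U M ==> (d + 2 * #|U| <= #|missed M|)].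
have P0 : P set0.
  by apply/forallP => M; apply/implyP => /minM0; rewrite cards0 addn0.
case: (@arg_maxnP _ set0 P (fun U => #|U|) P0) => U PU maxU; exists U.
have min_missed M : matching U M -> d + 2 * #|U| <= #|missed M|.
  by move=> matM; move/forallP/(_ M): PU; rewrite matM.
have all_missed x : x \notin U ->
    exists M, [/\ matching U M, #|missed M| = d + 2 * #|U| & x \in missed M].
  move=> xU; have : ~~ P (x |: U).
    by apply/negP => /maxU; rewrite cardsU1 xU; lia.
  rewrite negb_forall => /existsP[M]; rewrite negb_imply -ltnNge cardsU1 xU.
  case/andP=> matM ltM; have matUM := matchingS (subsetUr [set x] U) matM.
  exists M; split=> //; last by rewrite (subsetP (sub_missed matM)) // setU11.
  have := min_missed M matUM; have := odd_card_missed matUM.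
  have := odd_card_missed matM0; rewrite -/d; lia.
have /set0Pn[x] : ~: U != set0.
  apply: contraTneq d2 => UT; have := cardsC U.
  have := leq_trans (min_missed _ (mat_id U)) (max_card _).
  by rewrite UT cards0 addn0 -ltnNge => + cU; rewrite -cU; lia.
rewrite inE => /all_missed[M [matM cM _]].
by have := missed_odd_comps min_missed all_missed matM cM; lia.
Qed.

(** The set [U] is a minimal barrier: were the bound to fail for [W], then by
    parity the smaller set [U :\: W] would be a barrier too. *)
Theorem tutte_hall_barrier :
    ~~ odd #|V| -> (forall M, matching set0 M -> missed M != set0) ->
  exists U, #|U| + 2 <= #|odd_comps e U| /\
    forall W, W != set0 -> W \subset U -> #|W| + 2 <= #|odd_nbrs e U W|.
Proof.
move=> evV no_perfect; have [U0 barU0] := tutte_barrier evV no_perfect.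
pose P U := #|U| + 2 <= #|odd_comps e U|.
case: (@arg_minnP _ U0 P (fun U => #|U|) barU0) => U PU minU.
exists U; split=> // W W0 sWU.
have cW : #|W| + #|U :\: W| = #|U| by rewrite -(cardsID W U) (setIidPr sWU).
rewrite -card_gt0 in W0.
have : ~~ P (U :\: W) by apply/negP => /minU; lia.
rewrite /P -ltnNge => small.
have le1 : #|odd_comps e U| <= #|odd_comps e (U :\: W)| + #|odd_nbrs e U W|.
  rewrite -(cardsID (odd_nbrs e U W) (odd_comps e U)) addnC leq_add //.
    exact/subset_leq_card/odd_comps_setD.
  exact/subset_leq_card/subsetIr.
have := odd_card_odd_comps e_sym (U :\: W).
have := odd_card_odd_comps e_sym U.
have := cardsC U; have := cardsC (U :\: W).
move: PU; rewrite /P; lia.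
Qed.

End Matchings.

(** * Barriers against 2-factors *)

Definition outer_edges (T : finType) (G : sgraph T) (A B : {set T}) :
    {set T * T} :=
  [set p | [&& p.1 \in B, p.2 \notin A & G p.1 p.2]].

Definition hit_labels (T K : finType) (G : sgraph T) (A B : {set T})
    (kappa : T -> K) : {set K} :=
  [set kappa p.2 | p in outer_edges G A B].

(** A barrier in the sense of Tutte's f-factor theorem, for f = 2, with the
    properties that follow from its minimality. The labels [kappa] stand for the
    components of the graph without [A] and [B]. That a component is odd means
    in this theorem that it receives an odd number of edges from [B]. The last
    field says that the deficiency is positive. *)
Record barrier (T K : finType) (G : sgraph T) (A B : {set T}) (kappa : T -> K) :
    Prop := Barrier {
  barrier_disjoint : [disjoint A & B];
  barrier_adj : forall u v, u \notin A :|: B -> v \notin A :|: B -> G u v ->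
    kappa u = kappa v;
  barrier_indep : forall u v, u \in B -> G u v -> v \notin B;
  barrier_inj : forall u v w, (u, v) \in outer_edges G A B ->
    (u, w) \in outer_edges G A B -> kappa v = kappa w -> v = w;
  barrier_odd : forall k, k \in hit_labels G A B kappa ->
    odd #|[set p in outer_edges G A B | kappa p.2 == k]|;
  barrier_card : 2 * #|A| + #|outer_edges G A B| + 2
    <= 2 * #|B| + #|hit_labels G A B kappa| }.

Section Gadget.
Variables (T : finType) (G : sgraph T).
Implicit Types (u v b : T).

Definition dart := {p : T * T | G p.1 p.2}.
Implicit Types (p q : dart).

Definition src p : T := (val p).1.
Definition tgt p : T := (val p).2.

Lemma adj_dart p : G (src p) (tgt p).
Proof. exact: valP p. Qed.

Lemma rev_subproof p : G (tgt p, src p).1 (tgt p, src p).2.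
Proof. by rewrite adj_sym adj_dart. Qed.

Definition rev p : dart := Sub (tgt p, src p) (rev_subproof p).

Lemma dart_inj p q : src p = src q -> tgt p = tgt q -> p = q.
Proof.
rewrite /src /tgt => eq1 eq2; apply: val_inj; move: eq1 eq2.
by case: (val p) (val q) => ? ? [? ?] /= -> ->.
Qed.

Lemma src_rev p : src (rev p) = tgt p. Proof. by []. Qed.

Lemma tgt_rev p : tgt (rev p) = src p. Proof. by []. Qed.

Lemma revK : involutive rev.
Proof. by move=> p; apply: dart_inj. Qed.

Lemma rev_neq p : rev p != p.
Proof.
by apply/eqP => rp; have := adj_dart p; rewrite -{1}rp src_rev adj_irr.
Qed.

(** In a perfect matching of [gadget], the two copies of a vertex select two of
    the darts leaving it. The opposite of a selected dart must be matched to a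
    copy as well, hence is selected too, and so the selected darts form a
    2-factor. *)
Inductive gvertex := Copy of T & bool | Dart of dart.

Definition gvertex_code x : T * bool + dart :=
  match x with Copy u i => inl (u, i) | Dart p => inr p end.

Definition gvertex_decode x : gvertex :=
  match x with inl c => Copy c.1 c.2 | inr p => Dart p end.

Lemma gvertex_codeK : cancel gvertex_code gvertex_decode.
Proof. by case. Qed.

HB.instance Definition _ := Finite.copy gvertex (can_type gvertex_codeK).

Definition gadget : rel gvertex := fun x y =>
  match x, y with
  | Copy u _, Dart p | Dart p, Copy u _ => u == src p
  | Dart p, Dart q => q == rev p
  | Copy _ _, Copy _ _ => false
  end.

Lemma gadget_sym : symmetric gadget.
Proof.
by move=> [u i|p] [v j|q] //=; apply/eqP/eqP => ->; rewrite revK.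
Qed.

Lemma even_card_gadget : ~~ odd #|{: gvertex}|.
Proof.
pose swap x :=
  match x with Copy u i => Copy u (~~ i) | Dart p => Dart (rev p) end.
rewrite -cardsT (@odd_card_fixed_points _ swap); last 2 first.
- by move=> x; rewrite inE.
- by case=> [u i|p] _ /=; rewrite ?negbK ?revK.
suff -> : [set x in [set: gvertex] | swap x == x] = set0 by rewrite cards0.
apply/setP => x; rewrite !inE; apply/eqP; case: x => [u i|p] /=.
  by case; case: i.
by case=> /eqP; rewrite (negPf (rev_neq p)).
Qed.

Lemma perfect_matching_two_factor M :
    matching gadget set0 M -> missed M = set0 ->
  exists H : sgraph T, two_factor G H.
Proof.
case/matchingP => MK eM noM.
have {}eM x : gadget x (M x).
  by apply: (eM x _).2; move/setP/(_ x): noM; rewrite !inE => /negbT.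
pose at_copy p := if M (Dart p) is Copy _ _ then true else false.
pose h := [rel u v | [exists p, [&& src p == u, tgt p == v & at_copy p]]].
have at_copy_rev p : at_copy p -> at_copy (rev p).
  rewrite /at_copy.
  case Erp: (M (Dart (rev p))) (eM (Dart (rev p))) => [//|q] /=.
  by rewrite revK => /eqP Eq; rewrite -Eq -Erp MK.
have h_half u v : h u v -> h v u.
  case/existsP=> p /and3P[up vp cp]; apply/existsP; exists (rev p).
  by rewrite src_rev tgt_rev up vp at_copy_rev.
have h_sym : symmetric h by move=> u v; apply/idP/idP; apply: h_half.
have h_irr : irreflexive h.
  move=> u; apply/existsP => -[p /and3P[/eqP up /eqP vp _]].
  by have := adj_dart p; rewrite up vp adj_irr.
exists (SGraph h_sym h_irr); split=> [u v|u].
  by case/existsP=> p /and3P[/eqP <- /eqP <- _]; apply: adj_dart.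
have copyP i : exists p, M (Copy u i) = Dart p /\ src p = u.
  by case: (M (Copy u i)) (eM (Copy u i)) => //= p /eqP ->; exists p.
have [p0 [Mp0 sp0]] := copyP false; have [p1 [Mp1 sp1]] := copyP true.
have p01 : tgt p0 != tgt p1.
  apply/eqP => tp; have pp : p0 = p1 by apply: dart_inj; rewrite ?sp0 ?sp1.
  by move: Mp0; rewrite pp -Mp1 => /(can_inj MK).
rewrite /degree /=.
suff -> : [set v | h u v] = [set tgt p0; tgt p1] by rewrite cards2 p01.
apply/setP => v; rewrite !inE /=; apply/existsP/orP.
  case=> p /and3P[/eqP up /eqP <-]; rewrite /at_copy.
  case Ep: (M (Dart p)) (eM (Dart p)) => [w i|//] /= /eqP ws _.
  have : M (Copy u i) = Dart p by rewrite -up -ws -Ep MK.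
  by case: i {Ep} => [|]; rewrite ?Mp0 ?Mp1 => -[->]; [right|left].
by case=> /eqP ->; [exists p0; rewrite sp0 /at_copy -Mp0 MK !eqxx
                   |exists p1; rewrite sp1 /at_copy -Mp1 MK !eqxx].
Qed.

(** The barrier consists of the copies of [A] and of the darts leaving [B]. If
    it contains a copy of [u], three odd components meet the darts leaving [u],
    so the other copy of [u] cannot join these. If it contains a dart leaving
    [u], the two copies of [u] and the opposite dart lie in three different odd
    components; thus the copies are isolated, all darts leaving [u] belong to
    the barrier and no dart entering [u] does. *)
Section Barrier.
Variable U : {set gvertex}.
Hypothesis hallU : forall W : {set gvertex},
  W != set0 -> W \subset U -> #|W| + 2 <= #|odd_nbrs gadget U W|.
Hypothesis no_isolated : forall u, exists p, src p = u.

Local Notation cp := (component gadget U).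
Let A := [set u | Copy u false \in U].
Let B := [set u | [exists p, (src p == u) && (Dart p \in U)]].
Let kappa u := cp (Copy u false).

Let hall1 (w : gvertex) :
  w \in U -> 3 <= #|odd_nbrs gadget U [set w]|.
Proof.
move=> wU; rewrite -(cards1 w); have := @hallU [set w].
rewrite sub1set wU addn2 cards1; apply=> //.
by apply/set0Pn; exists w; rewrite inE.
Qed.

Let odd_nbrsP (W : {set gvertex}) C : C \in odd_nbrs gadget U W ->
  C \in odd_comps gadget U /\
  exists w x, [/\ w \in W, C = cp x, x \notin U & gadget w x].
Proof.
rewrite inE => /andP[oC /exists_inP[w wW /exists_inP[x xC wx]]]; split=> //.
by have [CE xU] := odd_comps_mem gadget_sym oC xC; exists w, x.
Qed.

Let copy_barrier u i : (Copy u i \in U) = (u \in A).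
Proof.
suff twin j : Copy u j \in U -> Copy u (~~ j) \in U.
  rewrite inE; case: i => //.
  by apply/idP/idP => [/twin|/twin].
move=> uU; apply: contraT => u'U.
suff sub : odd_nbrs gadget U [set Copy u j] \subset [set cp (Copy u (~~ j))].
  by have := leq_trans (hall1 uU) (subset_leq_card sub); rewrite cards1.
apply/subsetP => C /odd_nbrsP[_ [w [x [/set1P -> -> xU]]]].
case: x xU => // p pU /= up; rewrite in_set1; apply/eqP.
by rewrite (component_adj gadget_sym pU u'U up).
Qed.

Let dart_barrier_odd p (X := cp (Copy (src p) false))
    (Y := cp (Copy (src p) true)) (Z := cp (Dart (rev p))) :
    Dart p \in U ->
  [/\ X != Y, X \in odd_comps gadget U, Y \in odd_comps gadget U &
      Z \in odd_comps gadget U].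
Proof.
move=> pU; have sub : odd_nbrs gadget U [set Dart p] \subset [set X; Y; Z].
  apply/subsetP => C /odd_nbrsP[_ [w [x [/set1P -> -> _]]]].
  case: x => [u i|q] /= /eqP ->; rewrite !inE.
    by case: i; rewrite eqxx ?orbT.
  by rewrite eqxx !orbT.
have le3 := leq_trans (hall1 pU) (subset_leq_card sub).
have XY : X != Y.
  by apply: contraTneq le3 => ->; rewrite setUid cards2; case: eqVneq.
have card3 : #|[set X; Y; Z]| <= 3.
  by rewrite -setUA cardsU1 cards2; case: (_ \notin _); case: (_ != _).
have /eqP E : odd_nbrs gadget U [set Dart p] == [set X; Y; Z].
  by rewrite eqEcard sub (leq_trans card3 (hall1 pU)).
have oddE C : C \in [set X; Y; Z] -> C \in odd_comps gadget U.
  by rewrite -E => /odd_nbrsP[].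
by split=> //; apply: oddE; rewrite !inE eqxx ?orbT.
Qed.

Let notin_barrier (x : gvertex) : cp x \in odd_comps gadget U -> x \notin U.
Proof.
by move=> oC; have [] := odd_comps_mem gadget_sym oC (mem_component _ _ x).
Qed.

Let dart_barrier p : (Dart p \in U) = (src p \in B).
Proof.
rewrite inE; apply/idP/existsP => [pU|[q /andP[/eqP qp qU]]].
  by exists p; rewrite eqxx.
have [XY /notin_barrier XU /notin_barrier YU _] := dart_barrier_odd qU.
apply: contraNT XY => pU; apply/eqP.
rewrite [LHS](@component_adj _ _ gadget_sym _ _ (Dart p)) //;
  last by rewrite qp /=.
by rewrite -[RHS](@component_adj _ _ gadget_sym _ (Dart p)) //= qp.
Qed.

Let BP u : u \in B -> exists2 p, src p = u & Dart p \in U.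
Proof. by rewrite inE => /existsP[p /andP[/eqP up pU]]; exists p. Qed.

Let disjAB u : u \in B -> u \notin A.
Proof.
case/BP => p <- pU; have [_ /notin_barrier XU _ _] := dart_barrier_odd pU.
by rewrite copy_barrier in XU.
Qed.

Let indepB p : src p \in B -> tgt p \notin B.
Proof.
rewrite -dart_barrier => pU.
have [_ _ _ /notin_barrier ZU] := dart_barrier_odd pU.
by rewrite dart_barrier in ZU.
Qed.

Let rev_odd p : src p \in B -> cp (Dart (rev p)) \in odd_comps gadget U.
Proof. by rewrite -dart_barrier => /dart_barrier_odd[]. Qed.

Let kappa_rev p :
  src p \in B -> tgt p \notin A -> cp (Dart (rev p)) = kappa (tgt p).
Proof.
move=> pB pA.
rewrite (@component_adj _ _ gadget_sym _ _ (Copy (tgt p) false)) //=.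
  by rewrite dart_barrier indepB.
by rewrite copy_barrier.
Qed.

Let kappa_adj p :
    src p \notin A :|: B -> tgt p \notin A :|: B ->
  kappa (src p) = kappa (tgt p).
Proof.
rewrite !in_setU !negb_or => /andP[sA sB] /andP[tA tB].
have adjE := component_adj gadget_sym.
rewrite /kappa (adjE _ _ (Dart p)) ?copy_barrier ?dart_barrier //=.
rewrite (adjE _ _ (Dart (rev p))) ?dart_barrier //= ?revK //.
by rewrite (adjE _ _ (Copy (tgt p) false)) ?copy_barrier ?dart_barrier /=.
Qed.

(** All darts leaving [b] together meet as many odd components, besides the two
    copies of [b], as there are darts. *)
Let inj_rev b : b \in B ->
  {in [set p | src p == b] &, injective (fun p => cp (Dart (rev p)))}.
Proof.
move=> bB; set F := [set p | _].
apply/imset_injP; rewrite eqn_leq leq_imset_card /=.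
have [p0 sp0 p0U] := BP bB.
pose W : {set gvertex} := [set Dart p | p in F].
have cW : #|W| = #|F| by apply: card_imset => p q [].
have W0 : W != set0.
  by apply/set0Pn; exists (Dart p0); apply/imsetP; exists p0; rewrite ?inE ?sp0.
have WU : W \subset U.
  by apply/subsetP => _ /imsetP[p + ->]; rewrite inE dart_barrier => /eqP ->.
have := hallU W0 WU; rewrite cW => le1.
have sub : odd_nbrs gadget U W \subset
    [set cp (Copy b false); cp (Copy b true)]
      :|: [set cp (Dart (rev p)) | p in F].
  apply/subsetP => C /odd_nbrsP[_ [w [x [/imsetP[p pF ->] -> _]]]].
  have /eqP <- : src p == b by rewrite inE in pF.
  case: x => [u i|q] /= /eqP ->; rewrite !inE.
    by case: i; rewrite eqxx ?orbT.
  by apply/orP; right; apply/imsetP; exists p.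
have c2 : #|[set cp (Copy b false); cp (Copy b true)]| <= 2.
  by rewrite cards2; case: (_ != _).
have := leq_trans (leq_trans le1 (subset_leq_card sub)) (leq_card_setU _ _).
by move/leq_trans/(_ (leq_add c2 (leqnn _))); rewrite addnC leq_add2l.
Qed.

Let isolated_copy u i : u \in B -> cp (Copy u i) \subset [set Copy u i].
Proof.
move=> uB; apply: component_min; first exact: set11.
move=> y z /set1P -> /and3P[_ zU]; case: z zU => //= p.
by rewrite dart_barrier => /[swap] /eqP <-; rewrite uB.
Qed.

Let isolated_dart p :
  tgt p \in B -> src p \in A -> cp (Dart p) \subset [set Dart p].
Proof.
move=> pB pA; apply: component_min; first exact: set11.
move=> y z /set1P -> /and3P[_ zU]; case: z zU => [u i|q] /= + /eqP zE.
  by rewrite zE copy_barrier pA.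
by rewrite zE dart_barrier src_rev pB.
Qed.

(** Inside an odd component, an involution. Its number of fixed points is odd
    there, so an odd component is a copy of a vertex in [B] or contains an odd
    number of darts entering [B]. *)
Let swap x : gvertex :=
  match x with
  | Copy u i => if u \in B then x else Copy u (~~ i)
  | Dart p => if tgt p \in B then x else Dart (rev p)
  end.

Let odd_fixed_points D : D \in odd_comps gadget U ->
  odd #|[set x in D | swap x == x]|.
Proof.
move=> oD; have oddD : odd #|D| by move: oD; rewrite inE => /andP[].
rewrite -odd_card_fixed_points // => x xD;
  have [DE xU] := odd_comps_mem gadget_sym oD xD.
  rewrite DE; case: x xU {xD DE} => [u i|p] /= xU; case: ifPn => xB.
  - exact: mem_component.
  - have [p up] := no_isolated u; have pU : Dart p \notin U.
      by rewrite dart_barrier up.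
    have u'U : Copy u (~~ i) \notin U.
      by rewrite copy_barrier -(copy_barrier u i).
    rewrite (component_adj gadget_sym xU pU) /= ?up //.
    by rewrite (component_adj gadget_sym pU u'U) ?mem_component //= up.
  - exact: mem_component.
  have rU : Dart (rev p) \notin U by rewrite dart_barrier src_rev.
  by rewrite (component_adj gadget_sym xU rU) ?mem_component /=.
case: x xU {xD DE} => [u i|p] /= xU; case: ifPn => xB /=.
- by rewrite xB.
- by rewrite (negPf xB) negbK.
- by rewrite xB.
by rewrite tgt_rev -dart_barrier (negPf xU) revK.
Qed.

Let fixed_point x : x \notin U -> swap x == x ->
  (exists u i, u \in B /\ x = Copy u i) \/
  (exists2 p, src p \in B & x = Dart (rev p)).
Proof.
case: x => [u i|p] /= _; case: ifPn => [xB _|xB /eqP[]].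
- by left; exists u, i.
- by case: i.
- by right; exists (rev p); rewrite ?src_rev ?revK.
by move/eqP; rewrite (negPf (rev_neq p)).
Qed.

Let outer := [set p | (src p \in B) && (tgt p \notin A)].

Let outerE : outer_edges G A B = [set val p | p in outer].
Proof.
apply/setP => -[u v]; rewrite inE /=; apply/and3P/imsetP => [[uB vA uv]|].
  by exists (Sub (u, v) uv : dart); rewrite // in_set /src /tgt /= uB.
case=> p; rewrite in_set => /andP[pB pA] uv.
have [-> ->] : u = src p /\ v = tgt p by rewrite /src /tgt /= -uv.
by split=> //; apply: adj_dart.
Qed.

Let card_outer : #|outer_edges G A B| = #|outer|.
Proof. by rewrite outerE card_imset //; apply: val_inj. Qed.

Let hitE : hit_labels G A B kappa = [set kappa (tgt p) | p in outer].
Proof. by rewrite /hit_labels outerE -imset_comp. Qed.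

Let fiberE k : #|[set p in outer_edges G A B | kappa p.2 == k]|
  = #|[set p in outer | kappa (tgt p) == k]|.
Proof.
rewrite -(card_imset (mem [set p in outer | kappa (tgt p) == k]) val_inj).
congr #|pred_of_set _|; apply/setP => e; rewrite inE outerE.
apply/andP/imsetP => [[/imsetP[p pO ->] pk]|[p]].
  by exists p; rewrite // inE pO.
by rewrite inE => /andP[pO pk] ->; split=> //; apply: imset_f.
Qed.

Let odd_fiber k : k \in hit_labels G A B kappa ->
  odd #|[set p in outer_edges G A B | kappa p.2 == k]|.
Proof.
rewrite hitE fiberE => /imsetP[p0]; rewrite inE => /andP[p0B p0A] kE.
have oD := rev_odd p0B; have DE := kappa_rev p0B p0A; rewrite DE -kE in oD.
have p0D : Dart (rev p0) \in k by rewrite kE -DE mem_component.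
have DrevI : injective (fun p => Dart (rev p)).
  by move=> p q [tE sE]; apply: dart_inj.
rewrite -(card_imset (mem [set p in outer | kappa (tgt p) == k]) DrevI).
suff -> : [set Dart (rev p) | p in [set p in outer | kappa (tgt p) == k]]
    = [set x in k | swap x == x] by apply: odd_fixed_points.
apply/setP => x; apply/imsetP/setIdP => [[p]|[xk fx]].
  rewrite inE [p \in _]inE => /andP[/andP[pB pA] /eqP <-] ->.
  by rewrite -(kappa_rev pB pA) mem_component /= tgt_rev pB.
have [kE' xU] := odd_comps_mem gadget_sym oD xk; rewrite kE' in p0D.
have [[u [i [uB xE]]]|[p pB xE]] := fixed_point xU fx; subst x.
  by have := subsetP (isolated_copy i uB) _ p0D; rewrite inE.
exists p => //; rewrite inE [p \in _]inE pB.
have pA : tgt p \notin A.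
  apply: contra p0A => pA; have := @isolated_dart (rev p); rewrite tgt_rev.
  by move=> /(_ pB pA)/subsetP/(_ _ p0D)/set1P[-> _].
by rewrite pA kE' -kappa_rev /=.
Qed.

Let inner := [set p | (src p \in B) && (tgt p \in A)].

Let odd_comps_bound :
  #|odd_comps gadget U|
    <= 2 * #|B| + #|inner| + #|hit_labels G A B kappa|.
Proof.
pose copies := [set cp (Copy c.1 c.2) | c in setX B [set: bool]].
pose pendants := [set cp (Dart (rev p)) | p in inner].
have c1 : #|copies| <= 2 * #|B|.
  by rewrite (leq_trans (leq_imset_card _ _)) // cardsX cardsT card_bool mulnC.
have c2 : #|pendants| <= #|inner| by apply: leq_imset_card.
have sub : odd_comps gadget U \subset
    copies :|: pendants :|: hit_labels G A B kappa.
  apply/subsetP => D oD.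
  have /set0Pn[x] : [set x in D | swap x == x] != set0.
    by apply: contraTneq (odd_fixed_points oD) => ->; rewrite cards0.
  case/setIdP => xD fx; have [-> xU] := odd_comps_mem gadget_sym oD xD.
  rewrite !in_setU -orbA; apply/or3P.
  have [[u [i [uB ->]]]|[p pB ->]] := fixed_point xU fx.
    by apply: Or31; apply/imsetP; exists (u, i); rewrite // in_setX uB in_setT.
  case: (boolP (tgt p \in A)) => pA.
    by apply: Or32; apply/imsetP; exists p; rewrite // inE pB.
  apply: Or33; rewrite hitE kappa_rev //; apply: imset_f.
  by rewrite inE pB.
apply: leq_trans (subset_leq_card sub) _.
apply: leq_trans (leq_card_setU _ _) _; rewrite leq_add2r.
by apply: leq_trans (leq_card_setU _ _) _; apply: leq_add.
Qed.

Let card_barrier : 2 * #|A| + (#|inner| + #|outer|) <= #|U|.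
Proof.
pose copies := [set Copy c.1 c.2 | c in setX A [set: bool]].
pose darts := [set Dart p | p in [set p | src p \in B]].
have c1 : #|copies| = 2 * #|A|.
  rewrite card_imset; last by move=> [u i] [v j] /= [-> ->].
  by rewrite cardsX cardsT card_bool mulnC.
have c2 : #|darts| = #|inner| + #|outer|.
  rewrite card_imset; last by move=> p q [].
  rewrite -(cardsID [set p | tgt p \in A]); congr (_ + _);
    congr #|pred_of_set _|; apply/setP => p; rewrite !in_set //.
  by rewrite andbC.
have disj : [disjoint copies & darts].
  by apply/pred0P => x; apply/negP => /andP[/imsetP[c _ ->] /imsetP[p _]].
have <- : #|copies :|: darts| = 2 * #|A| + (#|inner| + #|outer|).
  by rewrite cardsU disjoint_setI0 // cards0 subn0 c1 c2.
apply: subset_leq_card; apply/subsetP => x.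
case/setUP=> [/imsetP[c + ->]|/imsetP[p + ->]].
  by rewrite copy_barrier inE => /andP[].
by rewrite dart_barrier inE.
Qed.

Hypothesis deficient : #|U| + 2 <= #|odd_comps gadget U|.

Lemma gadget_barrier :
  exists (A B : {set T}) (K : finType) (kappa : T -> K), barrier G A B kappa.
Proof.
exists A, B, _, kappa; split.
- by apply/pred0P => u /=; apply/negP => /andP[uA /disjAB]; rewrite uA.
- move=> u v uAB vAB uv.
  exact: (@kappa_adj (Sub (u, v) uv)).
- by move=> u v uB uv; apply: (@indepB (Sub (u, v) uv)).
- move=> u v w; rewrite outerE => /imsetP[p + pE] /imsetP[q + qE].
  have [up vp] : u = src p /\ v = tgt p by rewrite /src /tgt /= -pE.
  have [uq wq] : u = src q /\ w = tgt q by rewrite /src /tgt /= -qE.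
  rewrite [p \in _]in_set [q \in _]in_set => /andP[pB pA] /andP[qB qA].
  rewrite vp wq -!kappa_rev // => pq; congr tgt.
  by apply: (inj_rev pB) pq; rewrite inE // -up uq.
- exact: odd_fiber.
by rewrite card_outer; have := odd_comps_bound; have := card_barrier; lia.
Qed.

End Barrier.
End Gadget.

Theorem two_factor_or_barrier (T : finType) (G : sgraph T) :
    (forall u, exists v, G u v) ->
  (exists H, two_factor G H) \/
  exists (A B : {set T}) (K : finType) (kappa : T -> K), barrier G A B kappa.
Proof.
move=> no_isolated.
pose perfect M := matching (@gadget _ G) set0 M && (missed M == set0).
case: (pickP perfect) => [M /andP[matM /eqP perfM]|no_perfect]; [left|right].
  exact: perfect_matching_two_factor matM perfM.
have [|U [deficient hallU]] :=
    tutte_hall_barrier (@gadget_sym _ G) (@even_card_gadget _ G).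
  by move=> M matM; have := no_perfect M; rewrite /perfect matM /= => ->.
apply: (gadget_barrier hallU) deficient => u; have [v uv] := no_isolated u.
by exists (Sub (u, v) uv).
Qed.

(** * Toughness *)

Import Order.TTheory GRing.Theory Num.Theory.

Lemma min_degree_le (T : finType) (G : sgraph T) x : min_degree G <= degree G x.
Proof.
rewrite /min_degree; have : x \in index_enum T by rewrite mem_index_enum.
elim: (index_enum T) => // y s IH; rewrite inE big_cons => /orP[/eqP <-|xs].
  exact: geq_minl.
exact: leq_trans (geq_minr _ _) (IH xs).
Qed.

Lemma card_indep_le (T : finType) (G : sgraph T) (A : {set T}) :
  independent G A -> #|A| <= indep_num G.
Proof. by move=> indA; rewrite /indep_num (bigD1 A) //= leq_maxl. Qed.

Section Cuts.
Variables (T : finType) (G : sgraph T).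

(** The way in which all lower bounds on the number of components are proved: a
    labelling that is constant along edges is constant on components. *)
Lemma card_labels_le (K : finType) (S : {set T}) (f : T -> K) :
    (forall x y, x \notin S -> y \notin S -> G x y -> f x = f y) ->
  #|f @: ~: S| <= num_components (delete_vertices G S).
Proof.
move=> f_adj; set H := delete_vertices G S.
have f_connect u v : connect H u v -> f (val u) = f (val v).
  case/connectP=> p; elim: p u => [|w p IH] u /=; first by move=> _ ->.
  case/andP=> uw /IH{}IH /IH <-.
  by apply: f_adj uw; [have := valP u|have := valP w]; rewrite inE.
have H_sym : connect_sym H by apply/sym_connect_sym/adj_sym.
rewrite /num_components /n_comp_mem.
apply: leq_trans (leq_imset_card (fun u => f (val u)) _); apply/subset_leq_card.
apply/subsetP => k /imsetP[x xS ->]; pose u : {x | x \in ~: S} := Sub x xS.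
apply/imsetP; exists (fingraph.root H u); first by rewrite !inE roots_root.
by rewrite -(f_connect _ _ (connect_root H u)).
Qed.

Lemma tough_labels (K : finType) (S : {set T}) (f : T -> K) (t : rat) :
    (0 <= t)%R -> tough G t ->
    (forall x y, x \notin S -> y \notin S -> G x y -> f x = f y) ->
    2 <= #|f @: ~: S| ->
  (t * #|f @: ~: S|%:R <= #|S|%:R)%R.
Proof.
move=> t0 tG f_adj f2; have le_comp := card_labels_le f_adj.
have cutS : vertex_cut G S by apply: leq_trans le_comp.
have not_complete : ~~ complete G.
  case/card_gt1P: f2 => _ [_ [/imsetP[x xS ->] /imsetP[y yS ->] fxy]].
  apply/negP => /forallP/(_ x)/forallP/(_ y)/implyP xy.
  have x_neq_y : x != y by apply: contraNneq fxy => ->.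
  by rewrite !inE in xS yS; case/eqP: fxy; apply: f_adj (xy x_neq_y).
move: tG; rewrite /tough /toughness (negPf not_complete) => tG.
have {tG} := le_trans tG (bigmin_le_cond _ _ cutS).
rewrite lee_fin ler_pdivlMr ?ltr0n; last exact: ltnW cutS.
by apply: le_trans; rewrite ler_wpM2l // ler_nat.
Qed.

(** Otherwise deleting the neighbours of [x] isolates [x] at the cost of at most
    one vertex. *)
Lemma tough_degree (t : rat) :
  (1 <= t)%R -> tough G t -> 3 <= #|T| -> forall x, 2 <= degree G x.
Proof.
move=> t1 tG T3 x; rewrite leqNgt; apply/negP => deg1.
pose S := [set y | G x y]; pose f y := y == x.
have f_adj y z : y \notin S -> z \notin S -> G y z -> f y = f z.
  rewrite !inE /f => yS zS yz; apply/eqP/eqP => [yx|zx].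
    by rewrite -yx yz in zS.
  by rewrite -zx adj_sym yz in yS.
have xS : x \notin S by rewrite inE adj_irr.
have /set0Pn[y] : ~: (x |: S) != set0.
  rewrite -card_gt0 -(ltn_add2l #|x |: S|) cardsC addn0 cardsU1 xS.
  by apply: leq_trans T3; rewrite !ltnS.
rewrite !inE negb_or => /andP[yx yS].
have fS : [set f z | z in ~: S] = [set: bool].
  apply/setP => -[]; rewrite [RHS]inE; apply/imsetP.
    by exists x; rewrite /f ?eqxx // inE.
  by exists y; rewrite /f ?(negPf yx) // !inE.
have := tough_labels (le_trans ler01 t1) tG f_adj.
rewrite fS cardsT card_bool => /(_ isT) tS.
have : (#|S|%:R <= 1 :> rat)%R by rewrite (ler_nat _ _ 1) -ltnS.
by lra.
Qed.

Section BarrierCuts.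
Variables (K : finType) (A B : {set T}) (kappa : T -> K) (t : rat).
Hypothesis barAB : barrier G A B kappa.
Hypotheses (t0 : (0 <= t)%R) (tG : tough G t).

Let P := outer_edges G A B.
Let hit := hit_labels G A B kappa.

Lemma outer_edgeP p :
  p \in P -> [/\ p.1 \in B, p.2 \notin A, p.2 \notin B & G p.1 p.2].
Proof.
rewrite inE => /and3P[pB pA e]; split=> //.
exact: barrier_indep barAB _ _ pB e.
Qed.

Lemma tough_hit_labels : 2 <= #|hit| -> (t * #|hit|%:R <= #|A|%:R + #|B|%:R)%R.
Proof.
move=> hit2; have sub : hit \subset kappa @: ~: (A :|: B).
  apply/subsetP => _ /imsetP[p /outer_edgeP[_ pA pB _] ->].
  by apply: imset_f; rewrite in_setC in_setU negb_or pA.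
have le_hit := subset_leq_card sub.
have := tough_labels t0 tG (barrier_adj barAB) (leq_trans hit2 le_hit).
rewrite -natrD => le1.
apply: le_trans (_ : _ <= t * #|kappa @: ~: (A :|: B)|%:R)%R _.
  by rewrite ler_wpM2l // ler_nat.
by apply: le_trans le1 _; rewrite ler_nat leq_card_setU.
Qed.

(** Keep one edge to [B] for each odd component and delete the ends outside [B]
    of all the others, together with [A]. Now every component is joined to at
    most one vertex of [B], so the vertices of [B] are separated from each
    other. *)
Lemma tough_hit_edges (Z : {set T * T}) : 2 <= #|B| ->
    (forall k, k \in hit -> exists2 p, p \in P :\: Z & kappa p.2 = k) ->
  exists2 R : {set T * T}, R \subset P :\: Z & #|R| = #|hit| /\
    (t * #|B|%:R <= #|A|%:R + #|snd @: (P :\: R)|%:R)%R.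
Proof.
move=> B2 repZ; have /card_gt0P[b0 b0B] : 0 < #|B| by apply: leq_trans B2.
pose r k := odflt (b0, b0) [pick p in P :\: Z | kappa p.2 == k].
have rP k : k \in hit -> r k \in P :\: Z /\ kappa (r k).2 = k.
  move=> hk; rewrite /r; case: pickP => [p /andP[pP /eqP]|none] //=.
  by have [p pP /eqP pk] := repZ k hk; have := none p; rewrite pP pk.
exists (r @: hit); first by apply/subsetP => _ /imsetP[k /rP[rk _] ->].
split.
  rewrite card_in_imset // => k l hk hl kl.
  by rewrite -(rP k hk).2 kl (rP l hl).2.
(* A vertex outside [B] takes as label the vertex of [B] that the kept edge of
   its component leads to. *)
set W := snd @: _; pose f v := if v \in B then v else (r (kappa v)).1.
have f_star u v : u \in B -> v \notin A :|: W -> G u v -> f u = f v.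
  rewrite in_setU negb_or => uB /andP[vA vW] uv.
  rewrite /f uB (negPf (barrier_indep barAB uB uv)).
  have uvP : (u, v) \in P by rewrite inE uB vA.
  have : (u, v) \in r @: hit.
    apply: contraNT vW => nR; apply/imsetP; exists (u, v) => //.
    by rewrite inE nR.
  case/imsetP=> k hk uvE; have [_] := rP k hk.
  by rewrite -uvE /= => ->; rewrite -uvE.
have f_adj u v : u \notin A :|: W -> v \notin A :|: W -> G u v -> f u = f v.
  move=> uAW vAW uv; case: (boolP (u \in B)) => uB; first exact: f_star.
  case: (boolP (v \in B)) => vB; first by apply/esym/f_star; rewrite // adj_sym.
  move: uAW vAW; rewrite !in_setU !negb_or => /andP[uA _] /andP[vA _].
  rewrite /f (negPf uB) (negPf vB) (barrier_adj barAB _ _ uv) //.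
    by rewrite in_setU negb_or uA.
  by rewrite in_setU negb_or vA.
have sub : B \subset f @: ~: (A :|: W).
  apply/subsetP => b bB; apply/imsetP; exists b; last by rewrite /f bB.
  rewrite in_setC in_setU negb_or (disjointFl (barrier_disjoint barAB) bB) /=.
  apply/imsetP => -[p /setDP[/outer_edgeP[_ _ pB _] _] pE].
  by rewrite -pE bB in pB.
have le_B := subset_leq_card sub.
have := tough_labels t0 tG f_adj (leq_trans B2 le_B).
rewrite -natrD => le1.
apply: le_trans (_ : _ <= t * #|f @: ~: (A :|: W)|%:R)%R _.
  by rewrite ler_wpM2l // ler_nat.
by apply: le_trans le1 _; rewrite ler_nat leq_card_setU.
Qed.

Lemma card_outer_edges_ge : #|B| * (min_degree G - #|A|) <= #|P|.
Proof.
rewrite -sum_nat_const -[#|P|]sum1_card (partition_big fst (mem B)) /=; last first.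
  by move=> p /outer_edgeP[].
apply: leq_sum => u uB; rewrite sum1_card.
apply: (@leq_trans #|[set v | G u v] :\: A|).
  rewrite leq_subLR; apply: leq_trans (min_degree_le G u) _.
  rewrite /degree -(cardsID A) leq_add2r; apply/subset_leq_card/subsetIr.
rewrite -(card_imset _ (_ : injective (pair u))) => [|v w []] //.
apply/subset_leq_card/subsetP => _ /imsetP[v + ->]; rewrite in_setD in_set.
by case/andP=> vA uv; rewrite unfold_in /= eqxx andbT inE uB vA.
Qed.

End BarrierCuts.
End Cuts.

(** * Exchange argument and conclusion *)

Lemma card_snd_lt (T1 T2 : finType) (D : {set T1 * T2}) p q :
  p \in D -> q \in D -> p != q -> p.2 = q.2 -> #|snd @: D| < #|D|.
Proof.
move=> pD qD pq pq2; rewrite (cardsD1 p D) pD ltnS.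
apply: leq_trans (leq_imset_card snd (D :\ p)).
apply/subset_leq_card/subsetP => _ /imsetP[z zD ->].
case: (eqVneq z p) => [->|zp]; last by apply: imset_f; rewrite !inE zp.
by rewrite pq2; apply: imset_f; rewrite !inE eq_sym pq.
Qed.

Section Exchange.
Variables (T K : finType) (G : sgraph T) (A B : {set T}) (kappa : T -> K).
Hypothesis barAB : barrier G A B kappa.

(** If every outside neighbour of [B] has only one neighbour in [B], then a
    vertex of [B] can be exchanged for two of its outside neighbours. They lie
    in different components, so the set stays independent. *)
Lemma exchange_indep u :
    {in outer_edges G A B &, injective snd} ->
    u \in B -> #|A| + 2 <= degree G u ->
  #|B| < indep_num G.
Proof.
move=> inj2 uB degu.
have : 1 < #|[set v | G u v] :\: A|.
  have := cardsID A [set v | G u v].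
  have : #|[set v | G u v] :&: A| <= #|A| by apply/subset_leq_card/subsetIr.
  by move: degu; rewrite /degree; lia.
case/card_gt1P=> v [w [/setDP[+ vA] /setDP[+ wA] vw]]; rewrite !inE => uv uw.
have uvP : (u, v) \in outer_edges G A B by rewrite inE uB vA.
have uwP : (u, w) \in outer_edges G A B by rewrite inE uB wA.
have [_ _ vB _] := outer_edgeP barAB uvP.
have [_ _ wB _] := outer_edgeP barAB uwP; rewrite /= in vB wB.
have only x y : x \in B -> (u, y) \in outer_edges G A B -> G x y -> x = u.
  move=> xB uy xy; have [_ yA _ _] := outer_edgeP barAB uy.
  have xyP : (x, y) \in outer_edges G A B by rewrite inE xB yA.
  by have [] := inj2 _ _ xyP uy erefl.
have vw_adj : ~~ G v w.
  apply: contra vw => vw; apply/eqP; apply: (barrier_inj barAB uvP uwP).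
  by apply: (barrier_adj barAB) => //; rewrite in_setU negb_or ?vA ?wA.
pose I := v |: (w |: B :\ u).
have cI : #|I| = #|B|.+1.
  rewrite /I !cardsU1 !inE (negPf vw) (negPf vB) (negPf wB) !andbF.
  by rewrite (cardsD1 u B) uB.
rewrite -cI; apply: card_indep_le.
have half x y : x \in [set v; w] -> y \in I -> ~~ G y x.
  move=> xvw yI; have uxP : (u, x) \in outer_edges G A B.
    by case/set2P: xvw => ->.
  case/setU1P: yI => [->|/setU1P[->|/setD1P[yu yB]]].
  - by case/set2P: xvw => ->; rewrite ?adj_irr.
  - by case/set2P: xvw => ->; rewrite ?adj_irr // adj_sym.
  by apply: contra yu => yx; rewrite (only _ _ yB uxP yx).
apply/forall_inP => x xI; apply/forall_inP => y yI.
case: (boolP (y \in [set v; w])) => yvw; first exact: half.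
case: (boolP (x \in [set v; w])) => xvw; first by rewrite adj_sym half.
have inB z : z \in I -> z \notin [set v; w] -> z \in B.
  rewrite in_set2 negb_or => /setU1P[->|/setU1P[->|/setD1P[]]] //.
    by rewrite eqxx.
  by rewrite eqxx andbF.
by apply/negP => /(barrier_indep barAB (inB _ xI xvw)); rewrite inB.
Qed.

(** An odd component with two edges to [B] has a third one, so the edge that
    [tough_hit_edges] keeps can be chosen away from any two given edges with a
    common end. That end is deleted only once for the two edges. *)
Lemma tough_common_end (t : rat) p q : (0 <= t)%R -> tough G t -> 2 <= #|B| ->
    p \in outer_edges G A B -> q \in outer_edges G A B -> p != q -> p.2 = q.2 ->
  (t * #|B|%:R + #|hit_labels G A B kappa|%:R + 1
     <= #|A|%:R + #|outer_edges G A B|%:R)%R.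
Proof.
set P := outer_edges G A B => t0 tG B2 pP qP pq pq2.
have repZ k : k \in hit_labels G A B kappa ->
    exists2 z, z \in P :\: [set p; q] & kappa z.2 = k.
  move=> hk; have := barrier_odd barAB hk; set F := [set z in P | _] => oddF.
  case: (boolP (p \in F)) => pF; last first.
    have /imsetP[z zP kE] := hk; exists z => //; rewrite in_setD zP andbT.
    have zF : z \in F by rewrite inE zP kE eqxx.
    rewrite in_set2 negb_or; apply/andP; split; apply: contraNneq pF => zE.
      by rewrite -zE.
    by apply/setIdP; split=> //; rewrite pq2 -zE kE.
  have qF : q \in F by case/setIdP: pF => _ pk; apply/setIdP; rewrite -pq2.
  have : 0 < #|F :\ p :\ q|.
    move: oddF; rewrite (cardsD1 p) pF (cardsD1 q) !in_setD1 eq_sym pq qF.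
    by case: #|_|.
  case/card_gt0P => z; rewrite !in_setD1 => /and3P[zq zp /setIdP[zP /eqP kz]].
  by exists z => //; rewrite in_setD in_set2 negb_or zp zq.
have [R sub [cR le1]] := tough_hit_edges barAB t0 tG B2 repZ.
have notR z : z \in [set p; q] -> z \notin R.
  by move=> zZ; apply: contraL zZ => /(subsetP sub)/setDP[].
have lt2 : #|snd @: (P :\: R)| < #|P :\: R|.
  by apply: (@card_snd_lt _ _ _ p q) => //;
     rewrite in_setD ?pP ?qP andbT notR // !inE eqxx ?orbT.
have cP : #|P :\: R| + #|hit_labels G A B kappa| = #|P|.
  rewrite -cR -(cardsID R P) addnC (setIidPr _) //.
  exact: subset_trans sub (subsetDl _ _).
have : #|snd @: (P :\: R)| + #|hit_labels G A B kappa| + 1 <= #|P| by lia.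
by rewrite -(ler_nat rat) !natrD => le2; lra.
Qed.

End Exchange.

Local Open Scope ring_scope.

Theorem theorem2 (eps : rat) (T : finType) (G : sgraph T)
    (eps_gt0 : 0 < eps) (eps_le1 : eps <= 1)
    (G_tough : tough G (2 - eps))
    (card_ge3 : (3 <= #|T|)%N)
    (min_degree_ge : eps * (indep_num G)%:R <= (min_degree G)%:R) :
  exists H : sgraph T, two_factor G H.
Proof.
have t1 : 1 <= 2 - eps by lra.
have t0 : 0 <= 2 - eps by lra.
have deg2 := tough_degree t1 G_tough card_ge3.
have no_isolated u : exists v, G u v.
  have /card_gt0P[v] : (0 < degree G u)%N by apply: ltnW.
  by rewrite inE; exists v.
have [//|[A [B [K [kappa barAB]]]]] := two_factor_or_barrier no_isolated.
have cut_all := tough_hit_labels barAB t0 G_tough.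
have cut_star := tough_hit_edges barAB t0 G_tough.
have common := tough_common_end barAB t0 G_tough.
have degP := card_outer_edges_ge barAB.
have bar_card := barrier_card barAB.
have hitP : (#|hit_labels G A B kappa| <= #|outer_edges G A B|)%N.
  exact: leq_imset_card.
set P := outer_edges G A B in common degP bar_card hitP *.
set hit := hit_labels G A B kappa in cut_all common bar_card hitP.
have card_B : (#|A| + 1 <= #|B|)%N by lia.
(* If [B] is a single vertex, then [A] is empty and each of the at least two
   edges at this vertex leads to a component of its own, so the vertex is a cut
   vertex. *)
have B2 : (2 <= #|B|)%N.
  rewrite ltnNge; apply/negP => B1.
  have A0 : #|A| = 0%N by lia.
  have {}B1 : #|B| = 1%N by lia.
  have min2 : (2 <= min_degree G)%N.
    rewrite /min_degree; elim/big_rec: _ => [|x m _ m2]; first by apply: ltnW.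
    by rewrite leq_min deg2.
  have hit2 : (2 <= #|hit|)%N by lia.
  have := cut_all hit2; rewrite A0 B1 => le1.
  have le2 : #|hit|%:R <= (2 - eps) * #|hit|%:R by rewrite ler_peMl.
  have : 2 <= #|hit|%:R :> rat by rewrite (ler_nat _ 2).
  by lra.
have [|R sub [cR cut]] := cut_star set0 B2.
  by move=> k /imsetP[p pP ->]; exists p; rewrite // in_setD inE.
have AB : #|A|%:R + 2 <= eps * #|B|%:R :> rat.
  have : (#|snd @: (P :\: R)| + 2 + 2 * #|A| <= 2 * #|B|)%N.
    apply: leq_trans (_ : #|P :\: R| + 2 + 2 * #|A| <= _)%N.
      by rewrite !leq_add2r leq_imset_card.
    have : (#|P :\: R| + #|hit| = #|P|)%N.
      rewrite -cR -(cardsID R P) addnC (setIidPr _) //.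
      exact: subset_trans sub (subsetDl _ _).
    by move: bar_card; clear; lia.
  by rewrite -(ler_nat rat) !natrM !natrD; lra.
have ind : eps * #|B|%:R <= eps * (indep_num G)%:R.
  rewrite ler_wpM2l ?(ltW eps_gt0) // ler_nat; apply: card_indep_le.
  apply/forall_inP => u uB; apply/forall_inP => v vB.
  by apply: contraL vB => uv; apply: (barrier_indep barAB uB uv).
have min_ge : (#|A| + 2 <= min_degree G)%N.
  by rewrite -(ler_nat rat) natrD; lra.
have min_eq : min_degree G = (#|A| + 2)%N.
  apply/eqP; rewrite eqn_leq min_ge andbT leqNgt; apply/negP => min_gt.
  have P3 : (3 * #|B| <= #|P|)%N.
    by apply: leq_trans degP; rewrite mulnC leq_mul2l ltn_subRL min_gt orbT.
  have hit_gt : (#|A| + #|B| + 1 <= #|hit|)%N by move: P3 bar_card; clear; lia.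
  have hit2 : (2 <= #|hit|)%N by move: B2 hit_gt; clear; lia.
  have le1 := cut_all hit2.
  have le2 : #|hit|%:R <= (2 - eps) * #|hit|%:R by rewrite ler_peMl.
  by move: hit_gt; rewrite -(ler_nat rat) !natrD; lra.
have min_R : (min_degree G)%:R = #|A|%:R + 2 :> rat by rewrite min_eq natrD.
have indep_le : (indep_num G <= #|B|)%N.
  by rewrite -(ler_nat rat) -(ler_pM2l eps_gt0); lra.
have inj2 : {in P &, injective snd}.
  move=> p q pP qP pq2; apply/eqP; apply: contraT => pq.
  have := common p q B2 pP qP pq pq2.
  by move: bar_card; rewrite -(ler_nat rat) !natrD ?natrM; lra.
have /card_gt0P[u uB] : (0 < #|B|)%N by apply: ltnW.
have degu : (#|A| + 2 <= degree G u)%N by rewrite -min_eq min_degree_le.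
by have := exchange_indep barAB inj2 uB degu; rewrite ltnNge indep_le.
Qed.
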